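(* Let $(\mathcal{L},\circ_\lambda,[\cdot_\lambda\cdot])$ be a transposed Poisson conformal algebra. For any $h\in\mathcal{L}$, define a linear map $\alpha_h:\mathcal{L}\to\mathcal{L}$ by $\alpha_h(x):=(h\circ_\lambda x)|_{\lambda=0}$ for all $x\in\mathcal{L}$. Then $(\mathcal{L},[\cdot_\lambda\cdot],\alpha_h)$ is a Hom-Lie conformal algebra.
   Context: All vector spaces, linear maps and tensor products are over $\mathbb{C}$. For a vector space $A$, $A[\lambda]$ denotes polynomials in $\lambda$ with coefficients in $A$. A conformal algebra $(A,\circ_\lambda)$ is a $\mathbb{C}[\partial]$-module $A$ with a $\mathbb{C}$-bilinear map $A\otimes A\to A[\lambda]$, $a\otimes b\mapsto a\circ_\lambda b$, such that $(\partial a)\circ_\lambda b=-\lambda\, a\circ_\lambda b$ and $a\circ_\lambda(\partial b)=(\partial+\lambda)(a\circ_\lambda b)$. Convention: products are extended linearly to polynomials in formal variables. If $a\circ_\lambda b=\sum_n\lambda^n w_n$ and $\nu$ is a linear combination of formal variables, then $a\circ_{-\partial+\nu}b=\sum_n(-\partial+\nu)^n w_n$; the same convention applies to $[a_\lambda b]$. A commutative associative conformal algebra is a conformal algebra with $a\circ_\lambda(b\circ_\mu c)=(a\circ_\lambda b)\circ_{\lambda+\mu}c$ and $a\circ_\lambda b=b\circ_{-\partial-\lambda}a$ for all $a,b,c$. A Lie conformal algebra $(A,[\cdot_\lambda\cdot])$ is a conformal algebra (with product written $[a_\lambda b]$) such that $[a_\lambda b]=-[b_{-\lambda-\partial}a]$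 and $[a_\lambda[b_\mu c]]=[[a_\lambda b]_{\lambda+\mu}c]+[b_\mu[a_\lambda c]]$ for all $a,b,c$. A transposed Poisson conformal algebra (TPCA) is a $\mathbb{C}[\partial]$-module $\mathcal{L}$ with $\mathbb{C}$-bilinear maps $\circ_\lambda,[\cdot_\lambda\cdot]:\mathcal{L}\otimes\mathcal{L}\to\mathcal{L}[\lambda]$ such that $(\mathcal{L},\circ_\lambda)$ is a commutative associative conformal algebra, $(\mathcal{L},[\cdot_\lambda\cdot])$ is a Lie conformal algebra, and $2(a\circ_\lambda[b_\mu c])=[(a\circ_\lambda b)_{\lambda+\mu}c]+[b_\mu(a\circ_\lambda c)]$ for all $a,b,c\in\mathcal{L}$. A Hom-Lie conformal algebra $(A,[\cdot_\lambda\cdot],\alpha)$ is a $\mathbb{C}[\partial]$-module $A$ with a linear endomorphism $\alpha$ satisfying $\alpha\partial=\partial\alpha$ and a $\mathbb{C}$-bilinear map $[\cdot_\lambda\cdot]:A\otimes A\to A[\lambda]$ such that for all $a,b,c\in A$: $[(\partial a)_\lambda b]=-\lambda[a_\lambda b]$, $[a_\lambda(\partial b)]=(\partial+\lambda)[a_\lambda b]$; $[a_\lambda b]=-[b_{-\lambda-\partial}a]$; and $[\alpha(a)_\lambda[b_\mu c]]=[[a_\lambda b]_{\lambda+\mu}\alpha(c)]+[\alpha(b)_\mu[a_\lambda c]]$. *)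

(* Defs.v *)
From HB Require Import structures.
From mathcomp Require Import all_boot all_order all_algebra.
From mathcomp Require Import finmap.
From mathcomp Require Import reals complex.
From mathcomp Require Import monalg.

Set Warnings "-redundant-canonical-projection".
Set Implicit Arguments.
Unset Strict Implicit.
Unset Printing Implicit Defensive.

Import GRing.Theory.
Local Open Scope ring_scope.

(* [vpoly V n] is V[x_0, ..., x_(n-1)], the polynomials with coefficients in
   the module V: finitely supported families of elements of V indexed by
   multi-exponents.  The coefficient at the multi-exponent m is [p@_m], and
   [v%:MP] is the constant polynomial v. *)
Definition vpoly (V : zmodType) (n : nat) : Type := {malg V['X_{1..n}]}.

HB.instance Definition _ (V : zmodType) (n : nat) :=
  GRing.Zmodule.on (vpoly V n).

Definition vpoly_scale (K : nzRingType) (V : lmodType K) (n : nat)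
    (c : K) (p : vpoly V n) : vpoly V n :=
  [malg m in msupp p => c *: p@_m].

Section VpolyLmodule.
Variables (K : nzRingType) (V : lmodType K) (n : nat).
Implicit Types (c : K) (p : vpoly V n).

Lemma mcoeff_vpoly_scale c p m : (vpoly_scale c p)@_m = c *: p@_m.
Proof. by rewrite mcoeffE; case: msuppP; rewrite ?scaler0. Qed.

Fact vpoly_scaleA c d p :
  vpoly_scale c (vpoly_scale d p) = vpoly_scale (c * d) p.
Proof. by apply/malgP => m; rewrite !mcoeff_vpoly_scale scalerA. Qed.

Fact vpoly_scale1 : left_id 1 (@vpoly_scale K V n).
Proof. by move=> p; apply/malgP => m; rewrite mcoeff_vpoly_scale scale1r. Qed.

Fact vpoly_scaleDr : right_distributive (@vpoly_scale K V n) +%R.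
Proof.
move=> c p q; apply/malgP => m.
by rewrite mcoeffD !mcoeff_vpoly_scale mcoeffD scalerDr.
Qed.

Fact vpoly_scaleDl p : {morph (@vpoly_scale K V n)^~ p : c d / c + d}.
Proof.
move=> c d; apply/malgP => m.
by rewrite mcoeffD !mcoeff_vpoly_scale scalerDl.
Qed.

HB.instance Definition _ := GRing.Zmodule_isLmodule.Build K (vpoly V n)
  vpoly_scaleA vpoly_scale1 vpoly_scaleDr vpoly_scaleDl.

End VpolyLmodule.

Definition vmap (V : zmodType) (n : nat) (f : V -> V) (p : vpoly V n) :
    vpoly V n :=
  \sum_(m <- msupp p) << f p@_m *g m >>.

Definition mulmon (V : zmodType) (n : nat) (e : 'X_{1..n}) (p : vpoly V n) :
    vpoly V n :=
  \sum_(m <- msupp p) << p@_m *g mmul e m >>.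

Definition mulvar (V : zmodType) (n : nat) (i : 'I_n) : vpoly V n -> vpoly V n :=
  mulmon (ucm i).

(* For w = \sum_k x_0^k w_k, [vsubst T w] is \sum_k T^k w_k: the operator T on
   V[x_0, ..., x_(n-1)] is substituted for the variable, the powers of T being
   its iterated compositions. *)
Definition vsubst (V : zmodType) (n : nat) (T : vpoly V n -> vpoly V n)
    (w : vpoly V 1) : vpoly V n :=
  \sum_(k <- msupp w) iter (mdeg k) T (w@_k)%:MP.

Definition veval (K : nzRingType) (V : lmodType K) (c : K) (w : vpoly V 1) : V :=
  \sum_(k <- msupp w) c ^+ mdeg k *: w@_k.

(* The product a, b |-> f a b in V[x_0] with subscript T, extended linearly to
   polynomials p, q in formal variables:
   (x^i a) _T (x^j b) = x^(i + j) (a _T b). *)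
Definition extprod (V : zmodType) (f : V -> V -> vpoly V 1) (n : nat)
    (T : vpoly V n -> vpoly V n) (p q : vpoly V n) : vpoly V n :=
  \sum_(i <- msupp p) \sum_(j <- msupp q)
     mulmon (mmul i j) (vsubst T (f p@_i q@_j)).

(* A C[d]-module is represented by a C-vector space A with the linear
   endomorphism d : A -> A by which the indeterminate acts.  In A[lambda], the
   variable lambda is number 0; in A[lambda, mu], lambda is number 0 and mu is
   number 1. *)
Section ConformalAlgebras.
Variables (K : comNzRingType) (A : lmodType K) (d : {linear A -> A}).

Local Notation "'Alam'" := (vpoly A 1).
Local Notation "'Alammu'" := (vpoly A 2).

Local Notation lam1 := (@mulvar A 1 ord0).
Local Notation lam := (@mulvar A 2 ord0).
Local Notation mu := (@mulvar A 2 ord_max).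
Local Notation d1 := (@vmap A 1 d).

Record conformal_algebra (f : A -> A -> Alam) : Prop := ConformalAlgebra {
  conformal_bilinear : bilinear_for *:%R *:%R f;
  conformal_left : forall a b, f (d a) b = - lam1 (f a b);
  conformal_right : forall a b, f a (d b) = d1 (f a b) + lam1 (f a b)
}.

Record comm_assoc_conformal_algebra (f : A -> A -> Alam) : Prop :=
  CommAssocConformalAlgebra {
  comm_assoc_conformal : conformal_algebra f;
  conformal_assoc : forall a b c : A,
    extprod f lam a%:MP (extprod f mu b%:MP c%:MP) =
    extprod f (lam \+ mu) (extprod f lam a%:MP b%:MP) c%:MP :> Alammu;
  conformal_comm : forall a b : A, f a b = vsubst (\- d1 \- lam1) (f b a)
}.

Record lie_conformal_algebra (f : A -> A -> Alam) : Prop :=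
  LieConformalAlgebra {
  lie_conformal : conformal_algebra f;
  lie_conformal_skew : forall a b : A, f a b = - vsubst (\- lam1 \- d1) (f b a);
  lie_conformal_jacobi : forall a b c : A,
    extprod f lam a%:MP (extprod f mu b%:MP c%:MP) =
    extprod f (lam \+ mu) (extprod f lam a%:MP b%:MP) c%:MP +
    extprod f mu b%:MP (extprod f lam a%:MP c%:MP) :> Alammu
}.

Record transposed_poisson_conformal_algebra (f g : A -> A -> Alam) : Prop :=
  TransposedPoissonConformalAlgebra {
  tpca_comm_assoc : comm_assoc_conformal_algebra f;
  tpca_lie : lie_conformal_algebra g;
  tpca_leibniz : forall a b c : A,
    2%:R *: extprod f lam a%:MP (extprod g mu b%:MP c%:MP) =
    extprod g (lam \+ mu) (extprod f lam a%:MP b%:MP) c%:MP +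
    extprod g mu b%:MP (extprod f lam a%:MP c%:MP) :> Alammu
}.

Record hom_lie_conformal_algebra (f : A -> A -> Alam) (alpha : A -> A) : Prop :=
  HomLieConformalAlgebra {
  hom_lie_linear : linear alpha;
  hom_lie_commute : forall a : A, alpha (d a) = d (alpha a);
  hom_lie_conformal : conformal_algebra f;
  hom_lie_skew : forall a b : A, f a b = - vsubst (\- lam1 \- d1) (f b a);
  hom_lie_jacobi : forall a b c : A,
    extprod f lam (alpha a)%:MP (extprod f mu b%:MP c%:MP) =
    extprod f (lam \+ mu) (extprod f lam a%:MP b%:MP) (alpha c)%:MP +
    extprod f mu (alpha b)%:MP (extprod f lam a%:MP c%:MP) :> Alammu
}.

End ConformalAlgebras.

Definition mult_at0 (K : comNzRingType) (A : lmodType K)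
    (f : A -> A -> vpoly A 1) (h x : A) : A :=
  veval 0 (f h x).

(* Main.v *)
Require Import Defs.
From HB Require Import structures.
From mathcomp Require Import all_boot all_order all_algebra.
From mathcomp Require Import finmap.
From mathcomp Require Import reals complex.
From mathcomp Require Import monalg.

Set Implicit Arguments.
Unset Strict Implicit.
Unset Printing Implicit Defensive.

(** Write alpha for the operator x |-> (h o_lambda x) at lambda = 0.  Two facts
about it carry the theorem.

At lambda = 0 the compatibility 2 (h o_lambda [b_mu c]) =
[(h o_lambda b)_(lambda + mu) c] + [b_mu (h o_lambda c)] becomes
2 alpha [b_mu c] = [(alpha b)_mu c] + [b_mu (alpha c)], with alpha acting on
coefficients ([leibniz_at0]): alpha is a half-derivation of the bracket.
The same relation then holds for the products extended to A[lambda, mu]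
([vmap_extprod]), since alpha commutes with the variables.

Let X = [a_lambda [b_mu c]], Y = [[a_lambda b]_(lambda + mu) c] and
Z = [b_mu [a_lambda c]], so that X = Y + Z by the Jacobi identity.  Applying
4 alpha distributes alpha over the three arguments, an argument of the outer
bracket being hit with weight 2 and an argument of the inner one with weight 1.
The outer argument is a in X, c in Y and b in Z.  Subtracting the three Jacobi
identities for (alpha a, b, c), (a, alpha b, c) and (a, b, alpha c) lowers
every weight by one, so only the outer arguments keep alpha, and what is left is
the Hom-Jacobi identity ([half_derivation_hom_jacobi]).

That alpha commutes with d follows from h o_lambda (d x) =
(d + lambda) (h o_lambda x), whose term in lambda vanishes at lambda = 0. *)

Import GRing.Theory.
Local Open Scope ring_scope.
Local Open Scope complex_scope.

Local Notation "'additive_map' f" := {morph f : x y / x + y}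
  (at level 10, f at level 8).

(** * Additive maps *)

Section AdditiveMaps.
Variables (U V W : zmodType).

Definition biadditive (P : U -> V -> W) :=
  (forall q, additive_map (P^~ q)) /\ (forall p, additive_map (P p)).

Lemma additive_map0 (f : U -> V) : additive_map f -> f 0 = 0.
Proof. by move=> fD; apply: (addrI (f 0)); rewrite -fD !addr0. Qed.

Lemma additive_map_sum (f : U -> V) I (r : seq I) (E : I -> U) :
  additive_map f -> f (\sum_(i <- r) E i) = \sum_(i <- r) f (E i).
Proof.
by move=> fD; elim/big_rec2: _ => [|i y x _ <-]; rewrite ?fD // additive_map0.
Qed.

Lemma additive_map_comp (g : V -> W) (f : U -> V) :
  additive_map g -> additive_map f -> additive_map (g \o f).
Proof. by move=> gD fD x y /=; rewrite fD gD. Qed.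

Lemma additive_map_iter (T : U -> U) k :
  additive_map T -> additive_map (iter k T).
Proof. by move=> TD; elim: k => [|k IH] x y //; rewrite !iterS IH TD. Qed.

Lemma additive_map_add (f g : U -> V) :
  additive_map f -> additive_map g -> additive_map (f \+ g).
Proof. by move=> fD gD x y /=; rewrite fD gD addrACA. Qed.

End AdditiveMaps.

(** * Monomials and operators on polynomials *)

(** Locked, so that matching a monomial never unfolds the finitely supported
function that represents it. *)
HB.lock
Definition vmon (V : zmodType) (n : nat) (m : 'X_{1..n}) (v : V) : vpoly V n :=
  << v *g m >>.

Lemma iter_morph (X Y : Type) (h : X -> Y) (T : X -> X) (T' : Y -> Y) k x :
  {morph h : x / T x >-> T' x} -> h (iter k T x) = iter k T' (h x).
Proof. by move=> hT; elim: k => //= k <-. Qed.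

Section Monomials.
Variables (V : zmodType) (n : nat).
Implicit Types (v : V) (m k : 'X_{1..n}) (p : vpoly V n).

Lemma vmonD m : additive_map (@vmon V n m).
Proof. by move=> v w; rewrite vmon.unlock monalgUD. Qed.

Lemma vmonC v : v%:MP = vmon mone v :> vpoly V n.
Proof. by rewrite vmon.unlock. Qed.

Lemma vpolyE p : p = \sum_(m <- msupp p) vmon m p@_m.
Proof. by rewrite vmon.unlock; exact: monalgE. Qed.

Lemma mcoeff_vmon m v k : (vmon m v)@_k = v *+ (m == k).
Proof. by rewrite vmon.unlock mcoeffU. Qed.

Lemma msupp_vmon m v :
  msupp (vmon m v) = (if v == 0 then fset0 else [fset m])%fset.
Proof. by rewrite vmon.unlock msuppU. Qed.

End Monomials.

Section MonomialSums.
Variables (V W : zmodType) (n : nat).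
Implicit Types (p q : vpoly V n) (F : 'X_{1..n} -> V -> W).

(** The supports of p, q and p + q differ; since F m 0 = 0, the three sums can
be taken over one finite set that contains all of them. *)
Lemma sum_msupp_additive F :
  (forall m, additive_map (F m)) ->
  additive_map (fun p => \sum_(m <- msupp p) F m p@_m).
Proof.
move=> FD p q.
pose s := (msupp (p + q) `|` (msupp p `|` msupp q))%fset.
have widen (r : vpoly V n) : (msupp r `<=` s)%fset ->
    \sum_(m <- msupp r) F m r@_m = \sum_(m <- s) F m r@_m.
  move=> rs; apply: big_fset_incl => // m _ /mcoeff_outdom ->.
  by rewrite additive_map0.
rewrite !widen ?fsubsetUl //;
  try by rewrite fsubsetU // ?fsubsetUl ?fsubsetUr ?orbT.
by rewrite -big_split; apply: eq_bigr => m _; rewrite mcoeffD FD.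
Qed.

Lemma sum_msuppU F v m :
  (forall k, additive_map (F k)) ->
  \sum_(k <- msupp (vmon m v)) F k (vmon m v)@_k
    = F m v.
Proof.
move=> FD; rewrite msupp_vmon; have [->|_] := eqVneq v 0.
  by rewrite big_seq_fset0 additive_map0.
by rewrite big_seq_fset1 mcoeff_vmon eqxx.
Qed.

(** The induction principle for V[x_0, ..., x_(n-1)] used throughout: identities
between operators need only be checked on monomials. *)
Lemma vpoly_additive_eq (f g : vpoly V n -> W) :
  additive_map f -> additive_map g ->
  (forall v m, f (vmon m v) = g (vmon m v)) -> f =1 g.
Proof.
move=> fD gD fg p; rewrite (vpolyE p) (additive_map_sum _ _ fD).
by rewrite (additive_map_sum _ _ gD); apply: eq_bigr => m _.
Qed.

End MonomialSums.

Section Operators.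
Variables (V : zmodType) (n : nat).
Implicit Types (v : V) (e m : 'X_{1..n}) (p q : vpoly V n) (f : V -> V).

Lemma vmapE f p : vmap f p = \sum_(m <- msupp p) vmon m (f p@_m).
Proof. by rewrite vmon.unlock. Qed.

Lemma mulmonE e p : mulmon e p = \sum_(m <- msupp p) vmon (mmul e m) p@_m.
Proof. by rewrite vmon.unlock. Qed.

Lemma vmapD f : additive_map f -> additive_map (@vmap V n f).
Proof.
move=> fD p q; rewrite !vmapE.
apply: (sum_msupp_additive (F := fun m v => vmon m (f v))) => m v w.
by rewrite fD vmonD.
Qed.

Lemma vmapU f v m : additive_map f ->
  vmap f (vmon m v) = (vmon m (f v)).
Proof.
move=> fD; rewrite vmapE.
apply: (sum_msuppU (F := fun m v => vmon m (f v))) => k v' w.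
by rewrite fD vmonD.
Qed.

Lemma mulmonD e : additive_map (@mulmon V n e).
Proof.
move=> p q; rewrite !mulmonE.
apply: (sum_msupp_additive (F := fun m v => vmon (mmul e m) v)) => m.
exact: vmonD.
Qed.

Lemma mulvarD i : additive_map (@mulvar V n i).
Proof. exact: mulmonD. Qed.

Lemma mulmonU e v m :
  mulmon e (vmon m v) = (vmon (mmul e m) v).
Proof.
rewrite mulmonE; apply: (sum_msuppU (F := fun m v => vmon (mmul e m) v)) => k.
exact: vmonD.
Qed.

Lemma vmap_mulmon f e p : additive_map f ->
  vmap f (mulmon e p) = mulmon e (vmap f p).
Proof.
move=> fD; move: p; apply: vpoly_additive_eq.
- exact: (additive_map_comp (vmapD fD) (mulmonD e)).
- exact: (additive_map_comp (mulmonD e) (vmapD fD)).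
by move=> v m; rewrite mulmonU !vmapU // mulmonU.
Qed.

Lemma mulmon1 p : mulmon mone p = p.
Proof.
by move: p; apply: vpoly_additive_eq => [|| v m] //;
  rewrite ?mulmonU ?mul1m //; apply: mulmonD.
Qed.

End Operators.

Section Substitution.
Variables (V : zmodType) (n : nat).
Implicit Types (v : V) (f : V -> V) (T : vpoly V n -> vpoly V n).

Lemma vsubstD T : additive_map T -> additive_map (vsubst T).
Proof.
move=> TD; apply: (sum_msupp_additive
  (F := fun (k : 'X_{1..1}) v => iter (mdeg k) T v%:MP)) => k v w.
by rewrite !vmonC vmonD additive_map_iter.
Qed.

Lemma vsubstU T v k : additive_map T ->
  vsubst T (vmon k v) = iter (mdeg k) T v%:MP.
Proof.
move=> TD; apply: (sum_msuppU
  (F := fun (k : 'X_{1..1}) v => iter (mdeg k) T v%:MP)) => m v' w.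
by rewrite !vmonC vmonD additive_map_iter.
Qed.

Lemma vmap_vsubst f T w : additive_map f -> additive_map T ->
  (forall p, vmap f (T p) = T (vmap f p)) ->
  vmap f (vsubst T w) = vsubst T (vmap f w).
Proof.
move=> fD TD fT; move: w; apply: vpoly_additive_eq.
- exact: (additive_map_comp (vmapD fD) (vsubstD TD)).
- exact: (additive_map_comp (vsubstD TD) (vmapD fD)).
move=> v k; rewrite vmapU // !vsubstU //.
by rewrite (iter_morph _ _ fT) !vmonC (vmapU _ _ fD).
Qed.

End Substitution.

Section Extprod.
Variables (V : zmodType) (g : V -> V -> vpoly V 1).
Hypothesis gDl : forall b, additive_map (g^~ b).
Hypothesis gDr : forall a, additive_map (g a).
Variables (n : nat) (T : vpoly V n -> vpoly V n).
Hypothesis TD : additive_map T.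
Implicit Types p q : vpoly V n.

Let term (i j : 'X_{1..n}) a b := mulmon (mmul i j) (vsubst T (g a b)).

Let termDr i j a : additive_map (term i j a).
Proof. by move=> b c; rewrite /term gDr vsubstD // mulmonD. Qed.

Let termDl i q :
  additive_map (fun a => \sum_(j <- msupp q) term i j a q@_j).
Proof.
move=> a b; rewrite -big_split; apply: eq_bigr => j _ /=.
by rewrite /term gDl vsubstD // mulmonD.
Qed.

Lemma extprodDl q : additive_map (fun p => extprod g T p q).
Proof. exact: sum_msupp_additive (fun i => termDl i q). Qed.

Lemma extprodDr p : additive_map (extprod g T p).
Proof.
move=> q q'; rewrite -big_split; apply: eq_bigr => i _.
exact: (sum_msupp_additive (fun j => @termDr i j p@_i)).
Qed.

Lemma extprodUU a b i j :
  extprod g T (vmon i a) (vmon j b) = mulmon (mmul i j) (vsubst T (g a b)).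
Proof.
rewrite /extprod (sum_msuppU _ _ (fun k => termDl k _)).
exact: (sum_msuppU _ _ (fun k => @termDr i k a)).
Qed.

Lemma extprodCC a b : extprod g T a%:MP b%:MP = vsubst T (g a b).
Proof. by rewrite !vmonC extprodUU mul1m mulmon1. Qed.

(** On monomials x^i a and x^j b the product is x^(i + j) (a _T b).  An f that
commutes with T passes through x^(i + j) and through the substitution of T, so
the relation between f and g on V carries over to polynomials. *)
Lemma vmap_extprod f p q : additive_map f ->
    (forall r, vmap f (T r) = T (vmap f r)) ->
    (forall a b, vmap f (g a b) + vmap f (g a b) = g (f a) b + g a (f b)) ->
  vmap f (extprod g T p q) + vmap f (extprod g T p q) =
    extprod g T (vmap f p) q + extprod g T p (vmap f q).
Proof.
move=> fD fT fg.
have fn := @vmapD V n f fD.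
move: p; apply: vpoly_additive_eq => [||a i].
- have lD := additive_map_comp fn (extprodDl q).
  exact: (additive_map_add lD lD).
- exact: (additive_map_add (additive_map_comp (extprodDl q) fn) (extprodDl _)).
move: q; apply: vpoly_additive_eq => [||b j].
- have rD := additive_map_comp fn (extprodDr (vmon i a)).
  exact: (additive_map_add rD rD).
- exact: (additive_map_add (extprodDr _) (additive_map_comp (extprodDr _) fn)).
rewrite (vmapU a i fD) (vmapU b j fD) !extprodUU (vmap_mulmon _ _ fD).
rewrite (vmap_vsubst _ fD TD fT) -[LHS]mulmonD -[RHS]mulmonD.
by rewrite -[X in _ = mulmon _ X](vsubstD TD) -fg (vsubstD TD).
Qed.

End Extprod.

(** * Evaluation at lambda = 0 *)

Section SetLambdaZero.
Variable V : zmodType.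
Implicit Types (p : vpoly V 2) (w : vpoly V 1).

(** The exponent of mu in lambda^i mu^j, as an exponent of the only variable of
V[mu]. *)
Definition mu_exp (m : 'X_{1..2}) : 'X_{1..1} :=
  iter (m ord_max) (mmul (ucm ord0)) mone.

Lemma mu_expM e m : mu_exp (mmul e m) = mmul (mu_exp e) (mu_exp m).
Proof.
rewrite /mu_exp cmM; elim: (e ord_max) => [|k IH]; first by rewrite mul1m.
by rewrite addSn !iterS IH mulmA.
Qed.

(** The evaluation V[lambda, mu] -> V[mu] at lambda = 0: it drops the monomials
in which lambda occurs. *)
Definition lam0 p : vpoly V 1 :=
  \sum_(m <- msupp p) (if m ord0 == 0%N then vmon (mu_exp m) p@_m else 0).

Let term (m : 'X_{1..2}) (v : V) : vpoly V 1 :=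
  if m ord0 == 0%N then (vmon (mu_exp m) v) else 0.

Let termD m : additive_map (term m).
Proof. by move=> x y; rewrite /term; case: ifP; rewrite ?vmonD ?addr0. Qed.

Lemma lam0D : additive_map lam0.
Proof. exact: (sum_msupp_additive termD). Qed.

Lemma lam0U v (m : 'X_{1..2}) :
  lam0 (vmon m v) = if m ord0 == 0%N then (vmon (mu_exp m) v) else 0.
Proof. exact: (sum_msuppU v m termD). Qed.

Lemma lam0C v : lam0 v%:MP = v%:MP.
Proof. by rewrite !vmonC lam0U cm1 /mu_exp cm1. Qed.

Lemma lam0_mulmon e p :
  lam0 (mulmon e p) =
    if e ord0 == 0%N then mulmon (mu_exp e) (lam0 p) else 0.
Proof.
move: p; apply: vpoly_additive_eq => [x y|x y|v m].
- by rewrite mulmonD lam0D.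
- case: (e ord0 == 0%N) => /=; first by rewrite lam0D mulmonD.
  by rewrite addr0.
rewrite mulmonU !lam0U cmM addn_eq0; case: (e ord0 == 0%N) => /=; last by [].
case: (m ord0 == 0%N); first by rewrite mulmonU mu_expM.
by rewrite (additive_map0 (mulmonD _)).
Qed.

Local Notation lam := (@mulvar V 2 ord0).
Local Notation mu := (@mulvar V 2 ord_max).

Lemma lam0_mu p : lam0 (mu p) = mulvar ord0 (lam0 p).
Proof. by rewrite lam0_mulmon cmU /= /mu_exp cmUU /= mulm1. Qed.

Lemma lam0_lam p : lam0 (lam p) = 0.
Proof. by rewrite lam0_mulmon cmUU. Qed.

Lemma lam0_lam_mu p : lam0 ((lam \+ mu) p) = mulvar ord0 (lam0 p).
Proof.
have sum0 := congr2 +%R (lam0_lam p) (lam0_mu p).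
exact: (etrans (lam0D _ _) (etrans sum0 (add0r _))).
Qed.

(** A one-variable exponent is determined by its degree; this turns the powers
of operators in a substitution back into monomials. *)
Lemma mulvar_iter (v : V) (k : 'X_{1..1}) :
  iter (mdeg k) (mulvar ord0) v%:MP = vmon k v.
Proof.
have {2}-> : k = iter (mdeg k) (mmul (ucm ord0)) mone.
  apply/eqP/cmP => i; rewrite (ord1 i).
  have iterE j : iter j (mmul (ucm ord0)) mone ord0 = j :> nat.
    by elim: j => [|j IH]; rewrite ?cm1 // iterS cmM IH cmUU.
  rewrite iterE (mdegEw (d := [fset ord0]%fset)) ?big_seq_fset1 //.
  by apply/fsubsetP => j _; rewrite (ord1 j) inE.
rewrite vmonC; symmetry.
apply: (iter_morph (h := fun m => vmon m v)) => m.
by rewrite /mulvar mulmonU.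
Qed.

(** Both mu and lambda + mu qualify as T: they become the variable of V[mu] when
lambda = 0, and substituting the variable for itself changes nothing. *)
Lemma lam0_vsubst T w : additive_map T ->
  (forall p, lam0 (T p) = mulvar ord0 (lam0 p)) -> lam0 (vsubst T w) = w.
Proof.
move=> TD TE; move: w; apply: vpoly_additive_eq => [||v k] //.
  exact: (additive_map_comp lam0D (vsubstD TD)).
rewrite vsubstU // -mulvar_iter.
by rewrite (iter_morph _ _ TE) lam0C.
Qed.

Lemma lam0_vsubst_lam w : lam0 (vsubst lam w) = (w@_mone)%:MP.
Proof.
have lamD := @mulvarD V 2 ord0.
move: w; apply: vpoly_additive_eq => [||v k].
- exact: (additive_map_comp lam0D (vsubstD lamD)).
- by move=> x y; rewrite mcoeffD monalgUD.
rewrite vsubstU // mcoeff_vmon -mdeg_eq0.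
by case: (mdeg k) => [|j]; rewrite ?lam0C // iterS lam0_lam monalgU0.
Qed.

Lemma vsubst_var w : vsubst (mulvar ord0) w = w.
Proof.
have varD := @mulvarD V 1 ord0.
move: w; apply: vpoly_additive_eq => [||v k] //; first exact: vsubstD.
by rewrite vsubstU // mulvar_iter.
Qed.

Lemma mulvar_mone w : (mulvar ord0 w)@_mone = 0.
Proof.
move: w; apply: vpoly_additive_eq => [x y|x y|v k]; last 1 first.
- by rewrite /mulvar mulmonU mcoeff_vmon -mdeg_eq0 mdegM mdegU.
- by rewrite /mulvar mulmonD mcoeffD.
by rewrite addr0.
Qed.

End SetLambdaZero.

Section ProductsAtLambdaZero.
Variables (V : zmodType) (f : V -> V -> vpoly V 1).
Hypothesis fDl : forall b, additive_map (f^~ b).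
Hypothesis fDr : forall a, additive_map (f a).
Implicit Types p q : vpoly V 2.

(** Substituting lambda = 0 commutes with a product whose subscript becomes mu.
A monomial in which lambda occurs gives 0 on either side. *)
Lemma lam0_extprod T p q : additive_map T ->
  (forall r, lam0 (T r) = mulvar ord0 (lam0 r)) ->
  lam0 (extprod f T p q) = extprod f (mulvar ord0) (lam0 p) (lam0 q).
Proof.
move=> TD TE; have varD := @mulvarD V 1 ord0.
have extDl := extprodDl fDl; have extDr := extprodDr fDr.
have lD := @lam0D V.
move: p; apply: vpoly_additive_eq => [||a i].
- exact: (additive_map_comp lD (extDl _ _ TD q)).
- exact: (additive_map_comp (extDl _ _ varD _) lD).
move: q; apply: vpoly_additive_eq => [||b j].
- exact: (additive_map_comp lD (extDr _ _ TD _)).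
- exact: (additive_map_comp (extDr _ _ varD _) lD).
rewrite extprodUU // lam0_mulmon lam0_vsubst // !lam0U cmM addn_eq0.
have ext0l (r : vpoly V 1) : extprod f (mulvar ord0) 0 r = 0.
  exact: (additive_map0 (extDl _ _ varD r)).
have ext0r (r : vpoly V 1) : extprod f (mulvar ord0) r 0 = 0.
  exact: (additive_map0 (extDr _ _ varD r)).
case: (i ord0 == 0%N) => /=; last by rewrite ext0l.
case: (j ord0 == 0%N) => /=; last by rewrite ext0r.
by rewrite mu_expM (extprodUU fDl fDr varD) vsubst_var.
Qed.

(** With subscript lambda, only the constant term of f a x survives at
lambda = 0: the product with a acts on the coefficients by x |-> (f a x) at 0. *)
Lemma lam0_extprod_lam a p :
  lam0 (extprod f (mulvar ord0) a%:MP p) =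
    vmap (fun x => (f a x)@_mone) (lam0 p).
Proof.
have lamD := @mulvarD V 2 ord0.
have aD : additive_map (fun x => (f a x)@_mone).
  by move=> x y; rewrite fDr mcoeffD.
move: p; apply: vpoly_additive_eq => [||x m].
- exact: (additive_map_comp (@lam0D V) (extprodDr fDr lamD _)).
- exact: (additive_map_comp (vmapD aD) (@lam0D V)).
rewrite vmonC (extprodUU fDl fDr lamD) mul1m lam0_mulmon lam0_vsubst_lam lam0U.
case: (m ord0 == 0%N); last by rewrite (additive_map0 (vmapD aD)).
by rewrite (vmapU _ _ aD) vmonC mulmonU mulm1.
Qed.

End ProductsAtLambdaZero.

Section LeibnizAtLambdaZero.
Variables (V : zmodType) (f g : V -> V -> vpoly V 1).
Hypothesis fDl : forall b, additive_map (f^~ b).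
Hypothesis fDr : forall a, additive_map (f a).
Hypothesis gDl : forall b, additive_map (g^~ b).
Hypothesis gDr : forall a, additive_map (g a).

Local Notation lam := (@mulvar V 2 ord0).
Local Notation mu := (@mulvar V 2 ord_max).

Lemma leibniz_at0 (h b c : V) (alpha := fun x => (f h x)@_mone) :
  extprod f lam h%:MP (extprod g mu b%:MP c%:MP) *+ 2 =
    extprod g (lam \+ mu) (extprod f lam h%:MP b%:MP) c%:MP +
    extprod g mu b%:MP (extprod f lam h%:MP c%:MP) ->
  vmap alpha (g b c) + vmap alpha (g b c) = g (alpha b) c + g b (alpha c).
Proof.
have lamD := @mulvarD V 2 ord0.
have muD := @mulvarD V 2 ord_max.
have lmD := additive_map_add lamD muD.
have varD := @mulvarD V 1 ord0.
have fE x : lam0 (extprod f lam h%:MP x%:MP) = (alpha x)%:MP.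
  by rewrite (extprodCC fDl fDr lamD) lam0_vsubst_lam.
have gE x y : extprod g (mulvar ord0) x%:MP y%:MP = g x y.
  by rewrite (extprodCC gDl gDr varD) vsubst_var.
have EA : lam0 (extprod f lam h%:MP (extprod g mu b%:MP c%:MP)) =
    vmap alpha (g b c).
  rewrite (lam0_extprod_lam fDl fDr) (extprodCC gDl gDr muD).
  by rewrite (lam0_vsubst _ muD (@lam0_mu V)).
have EB : lam0 (extprod g (lam \+ mu) (extprod f lam h%:MP b%:MP) c%:MP) =
    g (alpha b) c.
  apply: (etrans (lam0_extprod gDl gDr _ _ lmD (@lam0_lam_mu V))).
  exact: (etrans (congr2 (extprod g _) (fE b) (lam0C c)) (gE _ _)).
have EC : lam0 (extprod g mu b%:MP (extprod f lam h%:MP c%:MP)) =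
    g b (alpha c).
  apply: (etrans (lam0_extprod gDl gDr _ _ muD (@lam0_mu V))).
  exact: (etrans (congr2 (extprod g _) (lam0C b) (fE c)) (gE _ _)).
move=> /(congr1 (@lam0 V)) leibniz.
have lam0_leibniz := etrans (etrans (esym (lam0D _ _)) leibniz) (lam0D _ _).
apply: (etrans (congr2 +%R (esym EA) (esym EA))).
exact: (etrans lam0_leibniz (congr2 +%R EB EC)).
Qed.

End LeibnizAtLambdaZero.

(** * The Hom-Jacobi identity for half-derivations *)

Section HomJacobi.
Variables (U V : zmodType) (iota : V -> U) (alpha : V -> V) (E : U -> U).
Variables P1 P2 P3 : U -> U -> U.

Definition half_derivation (P : U -> U -> U) :=
  forall p q, E (P p q) + E (P p q) = P (E p) q + P p (E q).

(** P1, P2 and P3 stand for one bracket with the subscripts lambda, mu and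
lambda + mu, and iota for the constant polynomials, the only arguments for which
the Jacobi identity is assumed.  Applied to a nested product, 4 E acts with
weight 2 on the argument of the outer product and with weight 1 on the two
others; three instances of the Jacobi identity are then cancelled. *)
Lemma half_derivation_hom_jacobi :
  additive_map E -> (forall v, E (iota v) = iota (alpha v)) ->
  biadditive P1 -> biadditive P2 -> biadditive P3 ->
  half_derivation P1 -> half_derivation P2 -> half_derivation P3 ->
  (forall a b c, P1 (iota a) (P2 (iota b) (iota c)) =
     P3 (P1 (iota a) (iota b)) (iota c) + P2 (iota b) (P1 (iota a) (iota c))) ->
  forall a b c, P1 (iota (alpha a)) (P2 (iota b) (iota c)) =
    P3 (P1 (iota a) (iota b)) (iota (alpha c)) +
    P2 (iota (alpha b)) (P1 (iota a) (iota c)).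
Proof.
move=> ED Eiota [_ P1Dr] [_ P2Dr] [P3Dl _] half1 half2 half3 jacobi a b c.
pose X u v w := P1 (iota u) (P2 (iota v) (iota w)).
pose Y u v w := P3 (P1 (iota u) (iota v)) (iota w).
pose Z u v w := P2 (iota v) (P1 (iota u) (iota w)).
pose E4 p := E p + E p + (E p + E p).
have E4D : additive_map E4.
  by move=> p q; rewrite /E4 !ED !addrA [LHS](ACl (1*3*5*7*2*4*6*8)).
(* One factor 2 of 4 E is spent on the outer product; the other one moves
   inside it and is spent on the inner product. *)
have E4X : E4 (X a b c) = X (alpha a) b c + X (alpha a) b c +
    (X a (alpha b) c + X a b (alpha c)).
  by rewrite /E4 half1 addrACA -[X in _ + X]P1Dr half2 P1Dr !Eiota.
have E4Y : E4 (Y a b c) = Y (alpha a) b c + Y a (alpha b) c +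
    (Y a b (alpha c) + Y a b (alpha c)).
  by rewrite /E4 half3 addrACA -[X in X + _]P3Dl half1 P3Dl !Eiota.
have E4Z : E4 (Z a b c) = Z a (alpha b) c + Z a (alpha b) c +
    (Z (alpha a) b c + Z a b (alpha c)).
  by rewrite /E4 half2 addrACA -[X in _ + X]P2Dr half1 P2Dr !Eiota.
have jacobiX u v w : X u v w = Y u v w + Z u v w by exact: jacobi.
rewrite -/(X (alpha a) b c) -/(Y a b (alpha c)) -/(Z a (alpha b) c).
(* What is added is the sum of the left-hand sides of the three Jacobi
   identities to be cancelled. *)
apply: (addIr (X (alpha a) b c + (X a (alpha b) c + X a b (alpha c)))).
rewrite addrA -E4X jacobiX E4D E4Y E4Z !jacobiX.
by rewrite [LHS](AC ((2*2)*(2*2)) (3*5*((1*7)*((2*6)*(4*8))))).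
Qed.

End HomJacobi.

(** * The operator of multiplication by h at lambda = 0 *)

Lemma vmap_mone (V : zmodType) (f : V -> V) (w : vpoly V 1) :
  additive_map f -> (vmap f w)@_mone = f w@_mone.
Proof.
move=> fD; move: w; apply: vpoly_additive_eq => [x y|x y|v k].
- by rewrite vmapD // mcoeffD.
- by rewrite mcoeffD fD.
by rewrite vmapU // !mcoeff_vmon; case: eqP; rewrite ?mulr0n ?additive_map0.
Qed.

(** The powers of 0 vanish except in degree 0, where 0 ^+ 0 = 1. *)
Lemma veval0 (K : nzRingType) (V : lmodType K) (w : vpoly V 1) :
  veval 0 w = w@_mone.
Proof.
pose F (k : 'X_{1..1}) (v : V) := (0 : K) ^+ mdeg k *: v.
have FD k : additive_map (F k) by move=> x y; rewrite /F scalerDr.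
move: w; apply: vpoly_additive_eq => [|x y|v k].
- exact: (sum_msupp_additive FD).
- by rewrite mcoeffD.
rewrite /veval (sum_msuppU v k FD) /F mcoeff_vmon expr0n mdeg_eq0.
by case: (k == mone); rewrite ?scale1r ?scale0r.
Qed.

Lemma bilinear_additive (K : nzRingType) (U V W : lmodType K)
    (f : U -> V -> W) :
  bilinear_for *:%R *:%R f -> biadditive f.
Proof.
case=> fl fr; split=> [v x y|u x y].
  have : f (1 *: x + y) v = 1 *: f x v + f y v by exact: fl.
  by rewrite !scale1r.
have : f u (1 *: x + y) = 1 *: f u x + f u y by exact: fr.
by rewrite !scale1r.
Qed.

Section MultiplicationAtZero.
Variables (K : comNzRingType) (L : lmodType K) (d : {linear L -> L}).
Variables (circ bracket : L -> L -> vpoly L 1).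
Hypothesis tpca : transposed_poisson_conformal_algebra d circ bracket.
Variable h : L.

Local Notation alpha := (mult_at0 circ h).
Local Notation lam := (@mulvar L 2 ord0).
Local Notation mu := (@mulvar L 2 ord_max).

Let circ_conformal := comm_assoc_conformal (tpca_comm_assoc tpca).
Let bracket_conformal := lie_conformal (tpca_lie tpca).

Let circDl := proj1
  (bilinear_additive (conformal_bilinear circ_conformal)).
Let circDr := proj2
  (bilinear_additive (conformal_bilinear circ_conformal)).
Let bracketDl := proj1
  (bilinear_additive (conformal_bilinear bracket_conformal)).
Let bracketDr := proj2
  (bilinear_additive (conformal_bilinear bracket_conformal)).

Lemma mult_at0E x : alpha x = (circ h x)@_mone.
Proof. exact: veval0. Qed.

Lemma mult_at0_linear : linear alpha.
Proof.
move=> k x y; rewrite !mult_at0E.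
rewrite ((conformal_bilinear circ_conformal).2 h k x y) mcoeffD.
by rewrite mcoeff_vpoly_scale.
Qed.

Lemma mult_at0D : additive_map alpha.
Proof. by move=> x y; have := mult_at0_linear 1 x y; rewrite !scale1r. Qed.

Lemma mult_at0_commute x : alpha (d x) = d (alpha x).
Proof.
have dD : additive_map d by move=> y z; rewrite linearD.
rewrite (mult_at0E (d x)) (mult_at0E x).
rewrite (conformal_right circ_conformal h x).
move: (mulvar_mone (circ h x)) (vmap_mone (circ h x) dD).
move: (mulvar ord0 (circ h x)) (vmap d (circ h x)) => p q p0 q0.
by rewrite mcoeffD p0 q0 addr0.
Qed.

Lemma mult_at0_half_derivation b c :
  vmap alpha (bracket b c) + vmap alpha (bracket b c) =
    bracket (alpha b) c + bracket b (alpha c).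
Proof.
have -> : vmap alpha (bracket b c) =
    vmap (fun x => (circ h x)@_mone) (bracket b c).
  by rewrite !vmapE; apply: eq_bigr => m _; rewrite mult_at0E.
rewrite (mult_at0E b) (mult_at0E c).
apply: (leibniz_at0 circDl circDr bracketDl bracketDr).
by rewrite -scaler_nat; apply: tpca_leibniz tpca h b c.
Qed.

Lemma mult_at0_hom_lie : hom_lie_conformal_algebra d bracket alpha.
Proof.
have lie := tpca_lie tpca.
split; [exact: mult_at0_linear|exact: mult_at0_commute|by []| |].
  exact: lie_conformal_skew lie.
have mulD i := @mulvarD L 2 i.
have aD := mult_at0D.
have a_mul (i : 'I_2) p : vmap alpha (mulvar i p) = mulvar i (vmap alpha p).
  exact: (vmap_mulmon _ _ aD).
have lmD := additive_map_add (mulD ord0) (mulD ord_max).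
have a_lm p : vmap alpha ((lam \+ mu) p) = (lam \+ mu) (vmap alpha p).
  exact: (etrans (vmapD aD _ _) (congr2 +%R (a_mul _ _) (a_mul _ _))).
have biadd T : additive_map T -> biadditive (@extprod L bracket 2 T).
  move=> TD; split; first exact: (extprodDl bracketDl TD).
  exact: (extprodDr bracketDr TD).
have half T : additive_map T ->
    (forall p, vmap alpha (T p) = T (vmap alpha p)) ->
    half_derivation (vmap alpha) (@extprod L bracket 2 T).
  move=> TD aT p q.
  apply: (vmap_extprod bracketDl bracketDr TD _ _ aD aT).
  exact: mult_at0_half_derivation.
apply: (half_derivation_hom_jacobi (E := vmap alpha) (vmapD aD) _
  (biadd _ (mulD ord0)) (biadd _ (mulD ord_max)) (biadd _ lmD)
  (half _ (mulD ord0) (a_mul ord0)) (half _ (mulD ord_max) (a_mul ord_max))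
  (half _ lmD a_lm) (lie_conformal_jacobi lie)) => v.
by rewrite !vmonC (vmapU _ _ aD).
Qed.

End MultiplicationAtZero.

Theorem proposition3p7 (R : realType) (L : lmodType R[i])
    (d : {linear L -> L}) (circ bracket : L -> L -> vpoly L 1) :
  transposed_poisson_conformal_algebra d circ bracket ->
  forall h : L, hom_lie_conformal_algebra d bracket (mult_at0 circ h).
Proof. exact: mult_at0_hom_lie. Qed.
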